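(* Let $A$ be a game, $\sigma$ a strategy on $A$, $\mathsf x_A$ a complete symmetry class of $A$ with chosen canonical representative $\hat{\mathsf x}_A$, and $\mathsf x^\sigma$ a symmetry class of $+$-covered configurations of $\sigma$ with $\partial_\sigma(x)\in\mathsf x_A$ for $x\in\mathsf x^\sigma$. Let $\hat{\mathsf x}^\sigma\in\mathsf x^\sigma$ be a chosen representative with $\partial_\sigma(\hat{\mathsf x}^\sigma)\cong^+_A\hat{\mathsf x}_A$. Let $\mathrm{wit}^+_\sigma[\mathsf x^\sigma]=\{x\in\mathsf x^\sigma\mid\partial_\sigma(x)\cong^+_A\hat{\mathsf x}_A\}$, let $\tilde{\mathsf x_A}_-$ be the set of negative symmetries $\hat{\mathsf x}_A\cong^-_A\hat{\mathsf x}_A$, and $\tilde{\mathsf x^\sigma}$ the set of symmetries $\hat{\mathsf x}^\sigma\cong_\sigma\hat{\mathsf x}^\sigma$. Then $$\sharp\,\mathrm{wit}^+_\sigma[\mathsf x^\sigma]=\frac{\sharp\,\tilde{\mathsf x_A}_-}{\sharp\,\tilde{\mathsf x^\sigma}}.$$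
   Context: Event structures: countable set of events, partial order $\le$ with finite down-sets, irreflexive symmetric conflict $\#$ with $e_1\#e_2\le e_2'\Rightarrow e_1\#e_2'$; configurations are finite down-closed conflict-free sets ($\mathscr C(E)$); $\rightarrow$ is immediate causality. An isomorphism family $\tilde E$: bijections between configurations, containing identities, closed under composition and inverse, each with a unique restriction to any sub-configuration of its domain and some extension to any configuration containing its domain; $\theta:x\cong_Ey$; symmetry classes are classes of configurations under existence of a symmetry. A tcg $A$: such a structure with symmetry-preserved polarity $\mathrm{pol}_A$ and subfamilies $\tilde A_+,\tilde A_-$ (positive/negative symmetries, $\cong^\pm_A$) meeting only in identities, each closed within $\tilde A$ under extension by pairs of events of its own polarity. A game adds a symmetry-invariant payoff $\kappa_A:\mathscr C(A)\to\{-1,0,+1\}$ (payoff $0$: complete) and a chosen canonical representative $\hat{\mathsf x}\in\mathsf x$ of each complete symmetry class $\mathsf x$, where $x$ is canonical if each $\theta:x\cong_Ax$ factors uniquely as $\theta^+\circ\theta^-$ with $\theta^-:x\cong^-_Ax$, $\theta^+:x\cong^+_Ax$. A strategy on a game $A$ is an event structure with symmetry $(\sigma,\tilde\sigma)$ with display $\partial_\sigma:|\sigma|\to|A|$ mapping configurations to configurations, injective on configurations, mapping symmetries to symmetries, and: ($\sim$-receptive) for $\theta:x\cong_\sigma y$, $x\cup\{s_1\}\in\mathscr C(\sigma)$ with $s_1$ negative and $\partial\theta\cup\{(\partial s_1,a_2)\}\in\tilde A$ there is a unique $s_2$ with $\theta\cup\{(s_1,s_2)\}\in\tilde\sigma$,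 $\partial s_2=a_2$; (thin) for $\theta:x\cong_\sigma y$ and $x\cup\{s_1\}\in\mathscr C(\sigma)$ with $s_1$ positive there is a unique $s_2$ with $y\cup\{s_2\}\in\mathscr C(\sigma)$ and $\theta\cup\{(s_1,s_2)\}\in\tilde\sigma$; minimal events negative; (courteous) $s_1\rightarrow s_2$ with $s_1$ positive or $s_2$ negative implies $\partial s_1\rightarrow\partial s_2$; (receptive) for $x\in\mathscr C(\sigma)$ and negative $a\notin\partial x$ with $\partial x\cup\{a\}\in\mathscr C(A)$ there is a unique $s$ with $x\cup\{s\}\in\mathscr C(\sigma)$, $\partial s=a$. Events have the polarity of their display; a configuration is $+$-covered if its maximal events are positive. $\sharp X$ denotes the cardinality of a finite set $X$. *)

(* Defs.v *)
From HB Require Import structures.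
From mathcomp Require Import all_boot all_order all_algebra.
From mathcomp Require Import finmap.
From mathcomp Require Import boolp classical_sets cardinality.

Set Implicit Arguments.
Unset Strict Implicit.
Unset Printing Implicit Defensive.

Import GRing.Theory Num.Theory.

Local Open Scope classical_set_scope.
Local Open Scope fset_scope.

Record event_structure := EventStructure {
  event :> countType;
  causal : rel event;
  conflict : rel event;
  causal_refl : reflexive causal;
  causal_anti : antisymmetric causal;
  causal_trans : transitive causal;
  causal_finite : forall e, finite_set [set e' | causal e' e];
  conflict_irr : irreflexive conflict;
  conflict_sym : symmetric conflict;
  conflict_inherit : forall e1 e2 e2',
    conflict e1 e2 -> causal e2 e2' -> conflict e1 e2'
}.

Definition configuration (E : event_structure) (x : {fset E}) : Prop :=
  (forall e e' : E, e \in x -> causal e' e -> e' \in x) /\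
  (forall e e' : E, e \in x -> e' \in x -> ~~ conflict e e').

Definition immediate (E : event_structure) (e e' : E) : Prop :=
  [/\ causal e e', e <> e' &
      forall c : E, causal e c -> causal c e' -> c = e \/ c = e'].

Definition maximal_in (E : event_structure) (x : {fset E}) (e : E) : Prop :=
  e \in x /\ forall e' : E, e' \in x -> causal e e' -> e' = e.

(* Bijections between configurations are represented by their (finite) graphs,
   so that restriction and extension are inclusion of graphs. *)
Definition gdom (T : choiceType) (th : {fset T * T}) : {fset T} :=
  [fset p.1 | p in th].

Definition gcod (T : choiceType) (th : {fset T * T}) : {fset T} :=
  [fset p.2 | p in th].

Definition is_bijection (T : choiceType) (th : {fset T * T}) : Prop :=
  {in th &, injective fst} /\ {in th &, injective snd}.

Definition gid (T : choiceType) (x : {fset T}) : {fset T * T} :=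
  [fset (e, e) | e in x].

Definition ginv (T : choiceType) (th : {fset T * T}) : {fset T * T} :=
  [fset (p.2, p.1) | p in th].

(* [gcomp th' th] is "th' after th". *)
Definition gcomp (T : choiceType) (th' th : {fset T * T}) : {fset T * T} :=
  [fset (p.1, q.2) | p in th, q in [fset q in th' | p.2 == q.1]].

Definition gimage (T U : choiceType) (f : T -> U) (th : {fset T * T}) :
    {fset U * U} :=
  [fset (f p.1, f p.2) | p in th].

Record iso_family (E : event_structure) := IsoFamily {
  sym :> {fset E * E} -> Prop;
  sym_bij : forall th, sym th ->
    [/\ is_bijection th, configuration (gdom th) & configuration (gcod th)];
  sym_id : forall x : {fset E}, configuration x -> sym (gid x);
  sym_comp : forall th th', sym th -> sym th' -> gcod th = gdom th' ->
    sym (gcomp th' th);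
  sym_inv : forall th, sym th -> sym (ginv th);
  sym_restrict : forall th (x : {fset E}), sym th ->
    configuration x -> x `<=` gdom th ->
    exists! th', [/\ sym th', th' `<=` th & gdom th' = x];
  sym_extend : forall th (x : {fset E}), sym th ->
    configuration x -> gdom th `<=` x ->
    exists th', [/\ sym th', th `<=` th' & gdom th' = x]
}.

Definition sym_from_to (E : event_structure) (F : iso_family E)
    (x y : {fset E}) (th : {fset E * E}) : Prop :=
  [/\ F th, gdom th = x & gcod th = y].

Definition symmetric_confs (E : event_structure) (F : iso_family E)
    (x y : {fset E}) : Prop :=
  exists th, sym_from_to F x y th.

Definition symmetry_class (E : event_structure) (F : iso_family E)
    (X : set {fset E}) : Prop :=
  exists2 x, configuration x & X = [set y | symmetric_confs F x y].

Variant polarity := Negative | Positive.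

(* Adding to [th] only pairs of events of polarity [p]. *)
Definition extends_by (T : choiceType) (pol : T -> polarity) (p : polarity)
    (th th' : {fset T * T}) : Prop :=
  th `<=` th' /\
  forall c, c \in th' -> c \notin th -> pol c.1 = p /\ pol c.2 = p.

Record tcg := Tcg {
  tcg_es :> event_structure;
  tcg_sym : iso_family tcg_es;
  pol : tcg_es -> polarity;
  tcg_pos : iso_family tcg_es;
  tcg_neg : iso_family tcg_es;
  pol_sym : forall th, tcg_sym th -> forall c, c \in th -> pol c.1 = pol c.2;
  tcg_pos_sub : forall th, tcg_pos th -> tcg_sym th;
  tcg_neg_sub : forall th, tcg_neg th -> tcg_sym th;
  tcg_pos_neg : forall th, tcg_pos th -> tcg_neg th -> th = gid (gdom th);
  tcg_pos_ext : forall th th', tcg_pos th -> tcg_sym th' ->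
    extends_by pol Positive th th' -> tcg_pos th';
  tcg_neg_ext : forall th th', tcg_neg th -> tcg_sym th' ->
    extends_by pol Negative th th' -> tcg_neg th'
}.

Definition canonical (A : tcg) (x : {fset A}) : Prop :=
  forall th, sym_from_to (tcg_sym A) x x th ->
  exists! pn : {fset A * A} * {fset A * A},
    [/\ sym_from_to (tcg_pos A) x x pn.1,
        sym_from_to (tcg_neg A) x x pn.2 &
        th = gcomp pn.1 pn.2].

Definition complete_class (A : tcg) (kappa : {fset A} -> int)
    (X : set {fset A}) : Prop :=
  symmetry_class (tcg_sym A) X /\ forall x, X x -> kappa x = 0%R.

(* [payoff] and [chosen] are total functions; only the values of [payoff] on
   configurations and of [chosen] on complete symmetry classes are meaningful. *)
Record game := Game {
  game_tcg :> tcg;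
  payoff : {fset game_tcg} -> int;
  payoff_range : forall x, configuration x ->
    [\/ payoff x = (-1)%R, payoff x = 0%R | payoff x = 1%R];
  payoff_sym : forall x y, symmetric_confs (tcg_sym game_tcg) x y ->
    payoff x = payoff y;
  chosen : set {fset game_tcg} -> {fset game_tcg};
  chosen_in : forall X, complete_class payoff X -> X (chosen X);
  chosen_canonical : forall X, complete_class payoff X -> canonical (chosen X)
}.

Record strategy (A : game) := Strategy {
  strat_es :> event_structure;
  strat_sym : iso_family strat_es;
  display : strat_es -> A;
  display_conf : forall x : {fset strat_es}, configuration x ->
    configuration (display @` x);
  display_inj : forall x : {fset strat_es}, configuration x ->
    {in x &, injective display};
  display_sym : forall th, strat_sym th -> tcg_sym A (gimage display th);
  sim_receptive : forall (x y : {fset strat_es}) th (s1 : strat_es) (a2 : A),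
    sym_from_to strat_sym x y th ->
    configuration (x `|` [fset s1]) ->
    pol (display s1) = Negative ->
    tcg_sym A (gimage display th `|` [fset (display s1, a2)]) ->
    exists! s2 : strat_es,
      strat_sym (th `|` [fset (s1, s2)]) /\ display s2 = a2;
  thin : forall (x y : {fset strat_es}) th (s1 : strat_es),
    sym_from_to strat_sym x y th ->
    configuration (x `|` [fset s1]) ->
    pol (display s1) = Positive ->
    exists! s2 : strat_es,
      configuration (y `|` [fset s2]) /\ strat_sym (th `|` [fset (s1, s2)]);
  minimal_negative : forall s : strat_es,
    (forall s', causal s' s -> s' = s) -> pol (display s) = Negative;
  courteous : forall s1 s2 : strat_es, immediate s1 s2 ->
    pol (display s1) = Positive \/ pol (display s2) = Negative ->
    immediate (display s1) (display s2);
  receptive : forall (x : {fset strat_es}) (a : A),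
    configuration x -> pol a = Negative ->
    a \notin display @` x ->
    configuration ((display @` x) `|` [fset a]) ->
    exists! s : strat_es,
      configuration (x `|` [fset s]) /\ display s = a
}.

Definition pos_covered (A : game) (sigma : strategy A)
    (x : {fset sigma}) : Prop :=
  forall s, maximal_in x s -> pol (display s) = Positive.

Definition wit_pos (A : game) (sigma : strategy A) (XA : set {fset A})
    (X : set {fset sigma}) : set {fset sigma} :=
  [set x | X x /\
    symmetric_confs (tcg_pos A) (@display A sigma @` x) (chosen XA)].

(* Main.v *)
Require Import Defs.
From mathcomp Require Import all_boot all_order all_algebra.
From mathcomp Require Import finmap.
From mathcomp Require Import boolp classical_sets functions cardinality.

(** A symmetry [th] from the display of a configuration [x] to [y] factors
    uniquely as [p o display f], with [f] a symmetry of the strategy from [x] and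
    [p] positive ([sym_lift], [sym_lift_uniq]).  Existence extends the
    factorisation one event at a time: a positive event is transported by thinness,
    and a negative one by ~-receptivity, once the positive part has been extended
    in the game.  Uniqueness holds because a symmetry of the strategy with positive
    display is an identity ([pos_display_gid]).

    Taking [x] := [xhat], the symmetries from its display to the chosen
    representative c are counted in two ways: by the factorisation they are
    #wit * #symX * #posA in number, and by canonicity of c they are #posA * #negA,
    where posA is the set of positive symmetries of c. *)

Set Implicit Arguments.
Unset Strict Implicit.
Unset Printing Implicit Defensive.

Local Open Scope fset_scope.

(** * Relational calculus of finite graphs *)

Section Graphs.
Variable T : choiceType.
Implicit Types (a b c : T) (x y : {fset T}) (f g h : {fset T * T}).

Lemma gdomP f a : reflect (exists b, (a, b) \in f) (a \in gdom f).
Proof.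
apply: (iffP (imfsetP _ _ _ _)) => [[[a' b] /= abf ->]|[b abf]]; first by exists b.
by exists (a, b).
Qed.

Lemma gcodP f b : reflect (exists a, (a, b) \in f) (b \in gcod f).
Proof.
apply: (iffP (imfsetP _ _ _ _)) => [[[a b'] /= abf ->]|[a abf]]; first by exists a.
by exists (a, b).
Qed.

Lemma mem_gid x a b : ((a, b) \in gid x) = (a \in x) && (a == b).
Proof.
apply/imfsetP/andP => [[c cx [-> ->]]|[ax /eqP <-]]; first by [].
by exists a.
Qed.

Lemma mem_ginv f a b : ((a, b) \in ginv f) = ((b, a) \in f).
Proof.
apply/imfsetP/idP => [[[c d] cdf [-> ->]]|baf]; first by [].
by exists (b, a).
Qed.

Lemma gcompP g f a c :
  reflect (exists2 b, (a, b) \in f & (b, c) \in g) ((a, c) \in gcomp g f).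
Proof.
apply: (iffP (imfset2P _ _ _ _ _)) => [[[a' b] /= abf [[b' c']]]|[b abf bcg]].
  by rewrite !inE /= => /andP[bcg /eqP bb'] [-> ->]; exists b; rewrite // bb'.
by exists (a, b) => //; exists (b, c) => //; rewrite !inE /= bcg /=.
Qed.

Lemma graph_eqP f g : (forall a b, (a, b) \in f = ((a, b) \in g)) <-> f = g.
Proof. by split=> [fg|-> //]; apply/fsetP => -[a b]. Qed.

Lemma graph_subP f g : reflect (forall a b, (a, b) \in f -> (a, b) \in g) (f `<=` g).
Proof.
apply: (iffP idP) => [/fsubsetP fg a b /fg //|fg].
by apply/fsubsetP => -[a b] /fg.
Qed.

Lemma gcompA h g f : gcomp h (gcomp g f) = gcomp (gcomp h g) f.
Proof.
apply/graph_eqP => a d; apply/gcompP/gcompP => [[c /gcompP[b abf bcg] cdh]|].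
  by exists b => //; apply/gcompP; exists c.
by case=> b abf /gcompP[c bcg cdh]; exists c => //; apply/gcompP; exists b.
Qed.

Lemma gcompS g g' f f' : g `<=` g' -> f `<=` f' -> gcomp g f `<=` gcomp g' f'.
Proof.
move=> gg' ff'; apply/graph_subP => a c /gcompP[b abf bcg].
by apply/gcompP; exists b; [exact: (fsubsetP ff')|exact: (fsubsetP gg')].
Qed.

Lemma ginvK : involutive (@ginv T).
Proof. by move=> f; apply/graph_eqP => a b; rewrite !mem_ginv. Qed.

Lemma ginvS f g : f `<=` g -> ginv f `<=` ginv g.
Proof.
by move=> fg; apply/graph_subP => a b; rewrite !mem_ginv; apply: (fsubsetP fg).
Qed.

Lemma gdom_gid x : gdom (gid x) = x.
Proof.
apply/fsetP => a; apply/gdomP/idP => [[b]|ax]; first by rewrite mem_gid => /andP[].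
by exists a; rewrite mem_gid ax /=.
Qed.

Lemma gcod_gid x : gcod (gid x) = x.
Proof.
apply/fsetP => a; apply/gcodP/idP => [[b]|ax].
  by rewrite mem_gid => /andP[bx /eqP <-].
by exists a; rewrite mem_gid ax /=.
Qed.

Lemma gdom_ginv f : gdom (ginv f) = gcod f.
Proof.
by apply/fsetP => a; apply/gdomP/gcodP => -[b abf]; exists b;
  move: abf; rewrite mem_ginv.
Qed.

Lemma gcod_ginv f : gcod (ginv f) = gdom f.
Proof. by rewrite -gdom_ginv ginvK. Qed.

Lemma gdom_gcomp g f : gcod f = gdom g -> gdom (gcomp g f) = gdom f.
Proof.
move=> fg; apply/fsetP => a; apply/gdomP/gdomP => [[c /gcompP[b abf _]]|[b abf]].
  by exists b.
have /gdomP[c bcg] : b \in gdom g by rewrite -fg; apply/gcodP; exists a.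
by exists c; apply/gcompP; exists b.
Qed.

Lemma gcod_gcomp g f : gcod f = gdom g -> gcod (gcomp g f) = gcod g.
Proof.
move=> fg; apply/fsetP => c; apply/gcodP/gcodP => [[a /gcompP[b _ bcg]]|[b bcg]].
  by exists b.
have /gcodP[a abf] : b \in gcod f by rewrite fg; apply/gdomP; exists c.
by exists a; apply/gcompP; exists b.
Qed.

Lemma gcomp_id_r f : gcomp f (gid (gdom f)) = f.
Proof.
apply/graph_eqP => a b; apply/gcompP/idP => [[c]|abf].
  by rewrite mem_gid => /andP[_ /eqP ->].
by exists a => //; rewrite mem_gid eqxx andbT; apply/gdomP; exists b.
Qed.

Lemma gcomp_id_l f : gcomp (gid (gcod f)) f = f.
Proof.
apply/graph_eqP => a b; apply/gcompP/idP => [[c acf]|abf].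
  by rewrite mem_gid => /andP[_ /eqP <-].
by exists b => //; rewrite mem_gid eqxx andbT; apply/gcodP; exists a.
Qed.

Lemma bij_fst f a b c : is_bijection f -> (a, b) \in f -> (a, c) \in f -> b = c.
Proof. by case=> inj1 _ abf acf; case: (inj1 _ _ abf acf erefl). Qed.

Lemma bij_snd f a b c : is_bijection f -> (a, c) \in f -> (b, c) \in f -> a = b.
Proof. by case=> _ inj2 acf bcf; case: (inj2 _ _ acf bcf erefl). Qed.

Lemma ginv_gcomp f : is_bijection f -> gcomp (ginv f) f = gid (gdom f).
Proof.
move=> bij_f; apply/graph_eqP => a c; rewrite mem_gid; apply/gcompP/andP.
  case=> b abf; rewrite mem_ginv => cbf; split; first by apply/gdomP; exists b.
  by apply/eqP; apply: bij_snd abf cbf.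
by case=> /gdomP[b abf] /eqP <-; exists b; rewrite ?mem_ginv.
Qed.

Lemma bijection_inv f : is_bijection f -> is_bijection (ginv f).
Proof.
move=> bij_f; split=> -[a b] [a' b']; rewrite !mem_ginv /= => abf abf' eq_ab.
  by move: abf; rewrite eq_ab => abf; rewrite (bij_snd bij_f abf abf').
by move: abf; rewrite eq_ab => abf; rewrite (bij_fst bij_f abf abf').
Qed.

Lemma gcomp_ginv f : is_bijection f -> gcomp f (ginv f) = gid (gcod f).
Proof.
by move=> /bijection_inv /ginv_gcomp; rewrite ginvK gdom_ginv.
Qed.

Lemma sub_mem_gdom f g a b : is_bijection g -> f `<=` g ->
  a \in gdom f -> (a, b) \in g -> (a, b) \in f.
Proof.
move=> bij_g /fsubsetP fg /gdomP[c acf] abg.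
by rewrite (bij_fst bij_g abg (fg _ acf)).
Qed.

Lemma sub_gdom_eq f g : is_bijection g -> f `<=` g -> gdom f = gdom g -> f = g.
Proof.
move=> bij_g fg eq_dom; apply/eqP; rewrite eqEfsubset fg; apply/graph_subP => a b abg.
by apply: (sub_mem_gdom bij_g fg) => //; rewrite eq_dom; apply/gdomP; exists b.
Qed.

Lemma gdomU1 f a b : gdom (f `|` [fset (a, b)]) = gdom f `|` [fset a].
Proof. by rewrite /gdom imfsetU imfset_fset1. Qed.

Lemma gcodU1 f a b : gcod (f `|` [fset (a, b)]) = gcod f `|` [fset b].
Proof. by rewrite /gcod imfsetU imfset_fset1. Qed.

Lemma gidU1 x a : gid (x `|` [fset a]) = gid x `|` [fset (a, a)].
Proof. by rewrite /gid imfsetU imfset_fset1. Qed.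

(** Puts a one-event enlargement into the form of one adjoined pair, the form in which [thin] and
    [sim_receptive] are stated. *)
Lemma sub_gdomU1 f g a : is_bijection g -> f `<=` g ->
  gdom g = gdom f `|` [fset a] -> exists b, g = f `|` [fset (a, b)].
Proof.
move=> bij_g fg dom_g.
have /gdomP[b abg] : a \in gdom g by rewrite dom_g !inE eqxx orbT.
exists b; apply/esym/(sub_gdom_eq bij_g); last by rewrite gdomU1.
by rewrite fsubUset fg fsub1set.
Qed.

End Graphs.

(** * Images of graphs under a map of events *)

Section GraphImages.
Variables (T U : choiceType) (d : T -> U).
Implicit Types (x : {fset T}) (f g : {fset T * T}).

Lemma gimageP f u v :
  reflect (exists a b, [/\ (a, b) \in f, u = d a & v = d b])
          ((u, v) \in gimage d f).
Proof.
apply: (iffP (imfsetP _ _ _ _)) => [[[a b] abf [-> ->]]|[a [b [abf -> ->]]]].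
  by exists a, b.
by exists (a, b).
Qed.

Lemma gdom_gimage f : gdom (gimage d f) = d @` gdom f.
Proof. by rewrite /gdom /gimage -!imfset_comp. Qed.

Lemma gcod_gimage f : gcod (gimage d f) = d @` gcod f.
Proof. by rewrite /gcod /gimage -!imfset_comp. Qed.

Lemma gimageU1 f a b :
  gimage d (f `|` [fset (a, b)]) = gimage d f `|` [fset (d a, d b)].
Proof. by rewrite /gimage imfsetU imfset_fset1. Qed.

Lemma gimageS f g : f `<=` g -> gimage d f `<=` gimage d g.
Proof.
move=> fg; apply/graph_subP => u v /gimageP[a [b [abf -> ->]]].
by apply/gimageP; exists a, b; split=> //; apply: (fsubsetP fg).
Qed.

Lemma gimage_gid x : gimage d (gid x) = gid (d @` x).
Proof. by rewrite /gid /gimage -!imfset_comp. Qed.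

Lemma gimage_ginv f : gimage d (ginv f) = ginv (gimage d f).
Proof. by rewrite /ginv /gimage -!imfset_comp. Qed.

(** Two pairs composable after applying [d] only share a middle value [d b = d b']. Injectivity on
    the middle set gives [b = b'], so they were composable before. *)
Lemma gimage_gcomp g f : {in gcod f &, injective d} -> gcod f = gdom g ->
  gimage d (gcomp g f) = gcomp (gimage d g) (gimage d f).
Proof.
move=> inj_d fg; apply/graph_eqP => u w; apply/gimageP/gcompP.
  case=> a [c [/gcompP[b abf bcg] -> ->]].
  by exists (d b); apply/gimageP; [exists a, b|exists b, c].
case=> v /gimageP[a [b [abf -> ->]]] /gimageP[b' [c [bcg bb' ->]]].
have eq_b : b = b'.
  by apply: inj_d => //; [|rewrite fg]; [apply/gcodP; exists a|apply/gdomP; exists c].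
by exists a, c; split=> //; apply/gcompP; exists b; rewrite // eq_b.
Qed.

End GraphImages.

(** * Cardinality of products, and induction on configurations *)

Lemma cardfsM (T U : choiceType) (A : {fset T}) (B : {fset U}) :
  #|` A `*` B| = (#|` A| * #|` B|)%N.
Proof.
have -> : A `*` B = [fset (val p.1, val p.2) | p in {: A * B}].
  apply/fsetP => -[a b]; rewrite in_fsetM /=; apply/andP/imfsetP => /=.
    by case=> aA bB; exists ([` aA], [` bB]).
  by case=> -[a' b'] _ [-> ->]; rewrite !fsvalP.
rewrite card_imfset /=.
  by rewrite -cardE card_prod !cardfE.
by move=> [a b] [a' b'] /= [] /val_inj -> /val_inj ->.
Qed.

(** An event [e] of [x] is either maximal or strictly below some [m] in [x]. In the latter case the
    events of [x] above [m] form a proper subset, which misses [e] by antisymmetry, and a maximal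
    event of that subset is maximal in [x]. *)
Lemma configuration_max (E : event_structure) (x : {fset E}) :
  x != fset0 -> exists m, maximal_in x m.
Proof.
elim/finSet_rect: x => x IH /fset0Pn[e ex].
have [[m [mx e_m ne_m]]|no_above] :=
    pselect (exists m, [/\ m \in x, causal e m & m <> e]); last first.
  exists e; split=> // e' e'x ee'; apply: contrapT => ne.
  by apply: no_above; exists e'.
pose x' := [fset e' in x | causal m e'].
have x'_proper : x' `<` x.
  rewrite fproperE; apply/andP; split.
    by apply/fsubsetP => a; rewrite !inE => /andP[].
  apply/negP => /fsubsetP /(_ e ex); rewrite !inE /= => /andP[_ m_e].
  by apply: ne_m; apply: causal_anti; rewrite m_e e_m.
have [|n [nx' n_max]] := IH _ x'_proper.
  by apply/fset0Pn; exists m; rewrite !inE /= mx causal_refl.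
move: nx'; rewrite !inE /= => /andP[nx m_n].
exists n; split=> // e' e'x n_e'; apply: n_max => //.
by rewrite !inE /= e'x (causal_trans m_n n_e').
Qed.

(** Removing a maximal event keeps a configuration down-closed, so every configuration is reached
    from the empty one by adding events one at a time. *)
Lemma configuration_ind (E : event_structure) (P : {fset E} -> Prop) :
  P fset0 ->
  (forall x m, configuration x -> m \notin x ->
     configuration (x `|` [fset m]) -> P x -> P (x `|` [fset m])) ->
  forall x, configuration x -> P x.
Proof.
move=> P0 PS; elim/finSet_rect => x IH conf_x.
have [->//|x_n0] := eqVneq x fset0.
have [m [mx m_max]] := configuration_max x_n0.
have eq_x : x = (x `\ m) `|` [fset m] by rewrite fsetUC fsetD1K.
have conf_x' : configuration (x `\ m).
  case: conf_x => down compat; split=> [e e'|e e'].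
    rewrite !inE => /andP[ne_em ex] e'_e; rewrite (down _ _ ex e'_e) andbT.
    apply: contra_neq ne_em => eq_e'; move: e'_e; rewrite eq_e'.
    exact: m_max.
  by rewrite !inE => /andP[_ ex] /andP[_ e'x]; apply: compat.
rewrite eq_x; apply: PS => //; first by rewrite !inE eqxx.
  by rewrite -eq_x.
by apply: IH => //; apply: fproperD1.
Qed.

(** * Groupoid laws, restriction and finiteness for isomorphism families *)

Section IsoFamilies.
Variables (E : event_structure) (F : iso_family E).
Implicit Types (x y z : {fset E}) (f g : {fset E * E}).

Lemma sym_is_bijection f : F f -> is_bijection f.
Proof. by case/sym_bij. Qed.

Lemma conf_gdom f : F f -> configuration (gdom f).
Proof. by case/sym_bij. Qed.

Lemma conf_gcod f : F f -> configuration (gcod f).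
Proof. by case/sym_bij. Qed.

Lemma sym_from_to_id x : configuration x -> sym_from_to F x x (gid x).
Proof. by move=> conf_x; split; [exact: sym_id|exact: gdom_gid|exact: gcod_gid]. Qed.

Lemma sym_from_to_comp x y z f g :
  sym_from_to F x y f -> sym_from_to F y z g -> sym_from_to F x z (gcomp g f).
Proof.
move=> [Ff <- cod_f] [Fg dom_g <-]; have fg : gcod f = gdom g by rewrite cod_f.
by split; [exact: sym_comp|exact: gdom_gcomp|exact: gcod_gcomp].
Qed.

Lemma sym_from_to_inv x y f : sym_from_to F x y f -> sym_from_to F y x (ginv f).
Proof.
move=> [Ff <- <-]; split; [exact: sym_inv|exact: gdom_ginv|exact: gcod_ginv].
Qed.

Lemma sym_comp_id_r x y f : sym_from_to F x y f -> gcomp f (gid x) = f.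
Proof. by move=> [_ <- _]; apply: gcomp_id_r. Qed.

Lemma sym_comp_id_l x y f : sym_from_to F x y f -> gcomp (gid y) f = f.
Proof. by move=> [_ _ <-]; apply: gcomp_id_l. Qed.

Lemma sym_inv_comp x y f : sym_from_to F x y f -> gcomp (ginv f) f = gid x.
Proof. by move=> [/sym_is_bijection Ff <- _]; apply: ginv_gcomp. Qed.

Lemma sym_comp_inv x y f : sym_from_to F x y f -> gcomp f (ginv f) = gid y.
Proof. by move=> [/sym_is_bijection Ff _ <-]; apply: gcomp_ginv. Qed.

(** First of four cancellation laws. Composition of graphs is total, but an inverse cancels only to
    the identity on one configuration, so matching endpoints have to be supplied. *)
Lemma sym_compK x y z f g : sym_from_to F x y f -> sym_from_to F y z g ->
  gcomp (ginv g) (gcomp g f) = f.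
Proof.
by move=> Ff Fg; rewrite gcompA (sym_inv_comp Fg) (sym_comp_id_l Ff).
Qed.

Lemma sym_compVK x y z f g : sym_from_to F x z f -> sym_from_to F y z g ->
  gcomp g (gcomp (ginv g) f) = f.
Proof.
by move=> Ff Fg; rewrite gcompA (sym_comp_inv Fg) (sym_comp_id_l Ff).
Qed.

Lemma sym_compKr x y z f g : sym_from_to F x y f -> sym_from_to F y z g ->
  gcomp (gcomp g f) (ginv f) = g.
Proof.
by move=> Ff Fg; rewrite -gcompA (sym_comp_inv Ff) (sym_comp_id_r Fg).
Qed.

Lemma sym_compVKr x y z f g : sym_from_to F x y f -> sym_from_to F x z g ->
  gcomp (gcomp g (ginv f)) f = g.
Proof.
by move=> Ff Fg; rewrite -gcompA (sym_inv_comp Ff) (sym_comp_id_r Fg).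
Qed.

Lemma symmetric_confs_sym x y : symmetric_confs F x y -> symmetric_confs F y x.
Proof. by move=> [f Ff]; exists (ginv f); apply: sym_from_to_inv. Qed.

Lemma symmetric_confs_trans x y z :
  symmetric_confs F x y -> symmetric_confs F y z -> symmetric_confs F x z.
Proof. by move=> [f Ff] [g Fg]; exists (gcomp g f); apply: sym_from_to_comp Fg. Qed.

Lemma symmetry_class_symmetric (X : set {fset E}) x y :
  symmetry_class F X -> X x -> X y -> symmetric_confs F x y.
Proof.
move=> [x0 _ ->] /= x0x x0y.
by apply: symmetric_confs_trans x0y; apply: symmetric_confs_sym.
Qed.

Lemma symmetry_class_closed (X : set {fset E}) x y :
  symmetry_class F X -> X x -> symmetric_confs F x y -> X y.
Proof. by move=> [x0 _ ->] /= x0x; apply: symmetric_confs_trans. Qed.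

Lemma sym_restrictE f x : F f -> configuration x -> x `<=` gdom f ->
  exists y g, sym_from_to F x y g /\ g `<=` f.
Proof.
move=> Ff conf_x x_f; have [g [[Fg gf dom_g] _]] := sym_restrict Ff conf_x x_f.
by exists (gcod g), g; split.
Qed.

(** A subgraph of a bijection is determined by its domain, so [f] is the restriction supplied by
    [sym_restrict]. This passes positivity of a display down to a restriction. *)
Lemma sub_sym f g : F g -> f `<=` g -> configuration (gdom f) -> F f.
Proof.
move=> Fg fg conf_f.
have dom_fg : gdom f `<=` gdom g.
  by apply/fsubsetP => a /gdomP[b /(fsubsetP fg) abg]; apply/gdomP; exists b.
have [h [[Fh hg dom_h] _]] := sym_restrict Fg conf_f dom_fg.
suff -> : f = h by [].
apply/graph_eqP => a b; have bij_g := sym_is_bijection Fg.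
apply/idP/idP => ab.
  apply: (sub_mem_gdom bij_g hg); last exact: (fsubsetP fg).
  by rewrite dom_h; apply/gdomP; exists b.
apply: (sub_mem_gdom bij_g fg); last exact: (fsubsetP hg).
by rewrite -dom_h; apply/gdomP; exists b.
Qed.

Lemma finite_sym_from_to x y : finite_set (sym_from_to F x y).
Proof.
apply: (sub_finite_set _ (finite_fset (fpowerset (x `*` y)))) => f /= [_ <- <-].
rewrite fpowersetE; apply/graph_subP => a b abf.
by rewrite in_fsetM; apply/andP; split; [apply/gdomP; exists b|apply/gcodP; exists a].
Qed.

End IsoFamilies.

(** * Factoring symmetries of the game through a strategy *)

Lemma pos_from_to_sub (A : tcg) (x y : {fset A}) f :
  sym_from_to (tcg_pos A) x y f -> sym_from_to (tcg_sym A) x y f.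
Proof. by move=> [/tcg_pos_sub]. Qed.

Lemma neg_from_to_sub (A : tcg) (x y : {fset A}) f :
  sym_from_to (tcg_neg A) x y f -> sym_from_to (tcg_sym A) x y f.
Proof. by move=> [/tcg_neg_sub]. Qed.

Section Strategies.
Variables (A : game) (sigma : strategy A).
Local Notation d := (@display A sigma).
Implicit Types (x y z : {fset sigma}) (f g : {fset sigma * sigma}).

Lemma display_from_to x y f : sym_from_to (strat_sym sigma) x y f ->
  sym_from_to (tcg_sym A) (d @` x) (d @` y) (gimage d f).
Proof.
move=> [Ff <- <-]; split; [exact: display_sym|exact: gdom_gimage|exact: gcod_gimage].
Qed.

Lemma display_comp x y z f g : sym_from_to (strat_sym sigma) x y f ->
  sym_from_to (strat_sym sigma) y z g ->
  gimage d (gcomp g f) = gcomp (gimage d g) (gimage d f).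
Proof.
move=> [Ff _ cod_f] [_ dom_g _]; apply: gimage_gcomp; last by rewrite cod_f.
exact/display_inj/(conf_gcod Ff).
Qed.

(** By induction [f] is the identity on [x] with one more pair [(m, s2)]. Both [m] and [s2] then
    satisfy the same uniqueness clause over [gid x]: that of [thin] if [m] is positive, that of
    [sim_receptive] if it is negative. *)
Lemma pos_display_gid x : configuration x ->
  forall f, strat_sym sigma f -> gdom f = x -> tcg_pos A (gimage d f) ->
  f = gid x.
Proof.
elim/configuration_ind: x / => [|x m conf_x m_x conf_xm IH] f Ff dom_f pos_f.
  by rewrite -[f]gcomp_id_r dom_f; apply/graph_eqP => a b; rewrite mem_gid inE;
    apply/gcompP => -[c]; rewrite mem_gid inE.
have [|y [g [[Fg dom_g cod_g] gf]]] := sym_restrictE Ff conf_x.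
  by rewrite dom_f fsubsetUl.
have pos_g : tcg_pos A (gimage d g).
  apply: sub_sym pos_f (gimageS d gf) _.
  by rewrite gdom_gimage dom_g; apply: display_conf.
have eq_g := IH _ Fg dom_g pos_g.
have [s2 eq_f] := sub_gdomU1 (sym_is_bijection Ff) gf
  (etrans dom_f (congr1 (fsetU^~ _) (esym dom_g))).
rewrite gidU1 eq_f eq_g; suff -> : s2 = m by [].
rewrite {}eq_g {dom_g cod_g} in eq_f Fg gf pos_g.
have id_xm : strat_sym sigma (gid x `|` [fset (m, m)]).
  by rewrite -gidU1; apply: sym_id.
have id_x := sym_from_to_id (strat_sym sigma) conf_x.
have conf_xs2 : configuration (x `|` [fset s2]).
  by move: (conf_gcod Ff); rewrite eq_f gcodU1 gcod_gid.
case pol_m : (pol (d m)); last first.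
  have [s [_ s_uniq]] := thin id_x conf_xm pol_m.
  by apply: etrans (esym (s_uniq s2 _)) (s_uniq m _); split; rewrite -?eq_f.
have eq_df : gimage d f = gid (d @` x) `|` [fset (d m, d s2)].
  by rewrite eq_f gimageU1 gimage_gid.
(* The display of [f] extends an identity by one negative pair, so it is negative as well as
   positive. It is therefore an identity, which forces [d s2 = d m]. *)
have neg_f : tcg_neg A (gimage d f).
  apply: (tcg_neg_ext (th := gid (d @` x))); first exact/sym_id/display_conf.
    exact: display_sym.
  rewrite eq_df; split=> [|[u v]]; first exact: fsubsetUl.
  rewrite !inE => /orP[->//|/eqP[-> ->]] _ /=; split=> //.
  rewrite -pol_m; apply/esym/(pol_sym (display_sym Ff) (c := (d m, d s2))).
  by rewrite eq_df !inE eqxx orbT.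
have dm : d s2 = d m.
  have : (d m, d s2) \in gimage d f by rewrite eq_df !inE eqxx orbT.
  by rewrite (tcg_pos_neg pos_f neg_f) mem_gid => /andP[_ /eqP].
have [|s [_ s_uniq]] := sim_receptive (a2 := d m) id_x conf_xm pol_m.
  by rewrite gimage_gid -[X in (_, X)]dm -eq_df; apply: display_sym.
by apply: etrans (esym (s_uniq s2 _)) (s_uniq m _); split; rewrite -?eq_f.
Qed.

(** The target [y] and [th] stay quantified because the induction hypothesis is applied to a
    restriction of [th], whose codomain is smaller. *)
Lemma sym_lift x : configuration x -> forall (y : {fset A}) th,
  sym_from_to (tcg_sym A) (d @` x) y th ->
  exists z f p, [/\ sym_from_to (strat_sym sigma) x z f,
    sym_from_to (tcg_pos A) (d @` z) y p & th = gcomp p (gimage d f)].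
Proof.
elim/configuration_ind: x / => [|x m conf_x m_x conf_xm IH] y th sym_th.
  have conf0 : configuration (fset0 : {fset sigma}) by split.
  exists fset0, (gid fset0), (gid (d @` fset0)).
  have th0 : th = gid (d @` fset0).
    apply/graph_eqP => a b; rewrite mem_gid imfset0 inE /=; apply/negP => abth.
    have : a \in gdom th by apply/gdomP; exists b.
    by case: sym_th => _ -> _; rewrite imfset0 inE.
  have -> : y = d @` fset0 by case: sym_th => _ _ <-; rewrite th0 gcod_gid.
  split; [exact: sym_from_to_id|exact/sym_from_to_id/display_conf|].
  by have := gcomp_id_r (gid (d @` fset0)); rewrite th0 gimage_gid gdom_gid.
have dxm : d @` (x `|` [fset m]) = (d @` x) `|` [fset d m].
  by rewrite imfsetU imfset_fset1.
have [Fth dom_th cod_th] := sym_th; have bij_th := sym_is_bijection Fth.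
have [|y' [th' [sym_th' sub_th]]] := sym_restrictE Fth (display_conf conf_x).
  by rewrite dom_th dxm fsubsetUl.
have [z [f [p [sym_f sym_p eq_th']]]] := IH _ _ sym_th'.
have sym_df := display_from_to sym_f.
case pol_m : (pol (d m)).
  (* Negative [m]. [sym_extend] prescribes the domain of the extension, whereas here the codomain
     [y] of the positive part is known; hence the inverse of [p] is extended. *)
  have [q [pos_q pq dom_q]] : exists q, [/\ tcg_pos A q, ginv p `<=` q & gdom q = y].
    have [pos_p _ cod_p] := sym_p.
    apply: (sym_extend (sym_inv pos_p)); first by rewrite -cod_th; apply: conf_gcod Fth.
    rewrite gdom_ginv cod_p -cod_th; case: sym_th' => _ _ <-.
    apply/fsubsetP => b /gcodP[a abth'].
    by apply/gcodP; exists a; apply: (fsubsetP sub_th).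
  have sym_q : sym_from_to (tcg_pos A) y (gcod q) q by [].
  have sym_r := sym_from_to_comp sym_th (pos_from_to_sub sym_q).
  (* Since [th'] is [p] after the display of [f], undoing [p] by [q] makes [gcomp q th] an extension
     of that display. Its one new pair [(d m, a2)] is what [sim_receptive] lifts. *)
  have sub_r : gimage d f `<=` gcomp q th.
    rewrite -(sym_compK sym_df (pos_from_to_sub sym_p)) -eq_th'.
    exact: gcompS.
  have [Fr dom_r cod_r] := sym_r.
  have [|a2 eq_r] := sub_gdomU1 (a := d m) (sym_is_bijection Fr) sub_r.
    by rewrite dom_r dxm gdom_gimage; case: sym_f => _ -> _.
  have [|s2 [[Ff' ds2] _]] := sim_receptive (a2 := a2) sym_f conf_xm pol_m.
    by rewrite -eq_r.
  have eq_df' : gimage d (f `|` [fset (m, s2)]) = gcomp q th.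
    by rewrite gimageU1 ds2.
  have cod_f' : d @` gcod (f `|` [fset (m, s2)]) = gcod q.
    by rewrite -gcod_gimage eq_df'.
  exists (gcod (f `|` [fset (m, s2)])), (f `|` [fset (m, s2)]), (ginv q); split.
  - by split=> //; rewrite gdomU1; case: sym_f => _ -> _.
  - by rewrite cod_f'; apply: sym_from_to_inv.
  - by rewrite eq_df' (sym_compK sym_th (pos_from_to_sub sym_q)).
(* Positive [m]. Thinness extends [f] to [f'] without reference to [th]; the other factor is then
   forced to be [th] after the inverse of the display of [f']. *)
have [s2 [[_ Ff'] _]] := thin sym_f conf_xm pol_m.
pose f' := f `|` [fset (m, s2)].
have sym_f' : sym_from_to (strat_sym sigma) (x `|` [fset m]) (gcod f') f'.
  by split=> //; rewrite gdomU1; case: sym_f => _ -> _.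
have sym_df' := display_from_to sym_f'.
have sym_p' := sym_from_to_comp (sym_from_to_inv sym_df') sym_th.
exists (gcod f'), f', (gcomp th (ginv (gimage d f'))); split=> //; last first.
  by rewrite (sym_compVKr sym_df' sym_th).
have [Fp' dom_p' cod_p'] := sym_p'; split=> //.
(* The forced factor extends [p], and a pair outside [p] can only start at [d s2], which has the
   polarity of [d m]. *)
have [pos_p _ _] := sym_p; apply: (tcg_pos_ext pos_p Fp'); split.
  rewrite -(sym_compKr sym_df (pos_from_to_sub sym_p)) -eq_th'.
  by apply: gcompS => //; apply/ginvS/gimageS/fsubsetUl.
move=> [u v] uvp' uvp /=.
suff pol_u : pol u = Positive by rewrite -(pol_sym Fp' uvp').
case/gcompP: (uvp') => a; rewrite mem_ginv gimageU1 in_fsetU in_fset1 => /orP[au av|].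
  case/negP: uvp; rewrite -(sym_compKr sym_df (pos_from_to_sub sym_p)) -eq_th'.
  apply/gcompP; exists a; rewrite ?mem_ginv //.
  apply: sub_mem_gdom bij_th sub_th _ av.
  by case: sym_th' => _ -> _; case: sym_df => _ <- _; apply/gdomP; exists u.
move=> /eqP[-> ->] _; rewrite -pol_m.
apply/esym/(pol_sym (display_sym Ff') (c := (d m, d s2))).
by rewrite gimageU1 !inE eqxx orbT.
Qed.

(** The symmetry [gcomp f' (ginv f)] has display [gcomp (ginv p') p], which is positive, so
    [pos_display_gid] makes it an identity. Hence [f = f'], and cancelling their common display
    gives [p = p']. *)
Lemma sym_lift_uniq x z z' (y : {fset A}) f f' p p' :
  sym_from_to (strat_sym sigma) x z f -> sym_from_to (strat_sym sigma) x z' f' ->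
  sym_from_to (tcg_pos A) (d @` z) y p -> sym_from_to (tcg_pos A) (d @` z') y p' ->
  gcomp p (gimage d f) = gcomp p' (gimage d f') ->
  [/\ z = z', f = f' & p = p'].
Proof.
move=> sym_f sym_f' pos_p pos_p' eq_pf.
have sym_g := sym_from_to_comp (sym_from_to_inv sym_f) sym_f'.
have [sym_df sym_df'] := (display_from_to sym_f, display_from_to sym_f').
have eq_dg : gimage d (gcomp f' (ginv f)) = gcomp (ginv p') p.
  rewrite (display_comp (sym_from_to_inv sym_f) sym_f') gimage_ginv.
  rewrite -(sym_compK sym_df' (pos_from_to_sub pos_p')) -eq_pf gcompA -gcompA.
  by rewrite -gcompA (sym_comp_inv sym_df) gcompA (sym_comp_id_r
    (sym_from_to_comp pos_p (sym_from_to_inv pos_p'))).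
have g_id : gcomp f' (ginv f) = gid z.
  have [Fg dom_g _] := sym_g.
  apply: pos_display_gid => //; first by rewrite -dom_g; apply: conf_gdom Fg.
  by rewrite eq_dg; case: (sym_from_to_comp pos_p (sym_from_to_inv pos_p')).
have eq_z : z = z' by case: sym_g => _ _ <-; rewrite g_id gcod_gid.
have eq_f : f = f'.
  by rewrite -(sym_compVKr sym_f sym_f') g_id (sym_comp_id_l sym_f).
split=> //; rewrite -(sym_compKr sym_df (pos_from_to_sub pos_p)) eq_pf eq_f.
exact: sym_compKr sym_df' (pos_from_to_sub pos_p').
Qed.

End Strategies.

(** * Counting by bijections *)

(** Finiteness of [B] is a conclusion because the set of witnesses is not known to be finite
    beforehand, and [fset_set] of an infinite set is empty by default. *)
Lemma card_fset_set_bij (T U : choiceType) (B : set T) (C : set U) (h : T -> U) :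
  set_bij B C h -> finite_set C ->
  finite_set B /\ #|` fset_set B| = #|` fset_set C|.
Proof.
move=> [h_fun h_inj h_surj] fin_C.
have eq_C : C = (h @` B)%classic.
  by apply/seteqP; split=> [c /h_surj //|_ [b Bb <-]]; apply: h_fun.
have eq_card : (B #= C)%card.
  by rewrite card_eq_sym eq_C; apply: inj_card_eq; exact: h_inj.
have fin_B : finite_set B by rewrite (eq_finite_set eq_card).
by split=> //; apply/(fcard_eq fin_B fin_C).
Qed.

(** Existence and uniqueness in [canonical] are surjectivity and injectivity here. *)
Lemma canonical_factor_bij (A : tcg) (x : {fset A}) :
  Defs.canonical x ->
  set_bij (sym_from_to (tcg_pos A) x x `*` sym_from_to (tcg_neg A) x x)%classic
    (sym_from_to (tcg_sym A) x x) (fun pn => gcomp pn.1 pn.2).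
Proof.
move=> can_fact; split.
- move=> [p n] [/= pos_p neg_n].
  exact: sym_from_to_comp (neg_from_to_sub neg_n) (pos_from_to_sub pos_p).
- move=> [p n] [p' n'] /set_mem[/= pos_p neg_n] /set_mem[/= pos_p' neg_n'] eq_pn.
  have sym_pn := sym_from_to_comp (neg_from_to_sub neg_n) (pos_from_to_sub pos_p).
  have [pn [_ pn_uniq]] := can_fact _ sym_pn.
  by apply: etrans (esym (pn_uniq (p, n) _)) (pn_uniq (p', n') _).
- move=> th /can_fact[pn [[pos_p neg_n eq_th] _]].
  by exists pn.
Qed.

(* The reference symmetries [k x] and [t x] turn a triple (x, f, p) into a
   symmetry from the display of [xhat] to [c], by [p o t x o display (k x o f)];
   [sym_lift] and [sym_lift_uniq] say that each arises exactly once. *)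
Lemma wit_lift_bij (A : game) (sigma : strategy A) (X : set {fset sigma})
    (xhat : {fset sigma}) (c : {fset A}) :
  symmetry_class (strat_sym sigma) X -> X xhat ->
  symmetric_confs (tcg_pos A) (@display A sigma @` xhat) c ->
  let wit : set {fset sigma} := [set x | X x /\
    symmetric_confs (tcg_pos A) (@display A sigma @` x)%fset c]%classic in
  exists h, set_bij (wit `*` sym_from_to (strat_sym sigma) xhat xhat
                         `*` sym_from_to (tcg_pos A) c c)%classic
                    (sym_from_to (tcg_sym A) c c) h.
Proof.
move=> X_class X_xhat xhat_c wit; pose d := @display A sigma.
(* Reference symmetries are chosen for all [x] at once; the value [fset0] outside [X], and for [t]
   outside [wit], is a dummy. *)
have /choice[k k_sym] x : exists f, X x -> sym_from_to (strat_sym sigma) xhat x f.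
  have [Xx|nXx] := pselect (X x); last by exists fset0.
  by have [f sym_f] := symmetry_class_symmetric X_class X_xhat Xx; exists f.
have /choice[t t_pos] x : exists p, wit x -> sym_from_to (tcg_pos A) (d @` x) c p.
  have [[_ [p pos_p]]|nwx] := pselect (wit x); first by exists p.
  by exists fset0.
have wit_xhat : wit xhat by [].
have pos_t0 := t_pos _ wit_xhat; have sym_t0 := pos_from_to_sub pos_t0.
pose lift w := gcomp (gcomp w.2 (t w.1.1)) (gimage d (gcomp (k w.1.1) w.1.2)).
have lift_sym w : wit w.1.1 -> sym_from_to (strat_sym sigma) xhat xhat w.1.2 ->
    sym_from_to (tcg_pos A) c c w.2 ->
    [/\ sym_from_to (strat_sym sigma) xhat w.1.1 (gcomp (k w.1.1) w.1.2),
        sym_from_to (tcg_pos A) (d @` w.1.1) c (gcomp w.2 (t w.1.1)) &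
        sym_from_to (tcg_sym A) (d @` xhat) c (lift w)].
  move=> wit_x sym_f pos_p.
  have sym_kf := sym_from_to_comp sym_f (k_sym _ wit_x.1).
  have pos_pt := sym_from_to_comp (t_pos _ wit_x) pos_p.
  split=> //; apply: sym_from_to_comp (pos_from_to_sub pos_pt).
  exact: display_from_to.
(* Precomposing with the inverse of [t xhat] moves the source from the display of [xhat] to [c], so
   that the set counted is the one that canonicity of [c] factors. *)
exists (fun w => gcomp (lift w) (ginv (t xhat))); split.
- move=> w [[wit_x sym_f] pos_p]; have [_ _ sym_w] := lift_sym _ wit_x sym_f pos_p.
  exact: sym_from_to_comp (sym_from_to_inv sym_t0) sym_w.
- move=> w w' /set_mem[[wit_x sym_f] pos_p] /set_mem[[wit_x' sym_f'] pos_p'] eq_w.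
  have [sym_kf pos_pt sym_w] := lift_sym _ wit_x sym_f pos_p.
  have [sym_kf' pos_pt' sym_w'] := lift_sym _ wit_x' sym_f' pos_p'.
  have eq_lift : lift w = lift w'.
    by rewrite -(sym_compVKr sym_t0 sym_w) eq_w (sym_compVKr sym_t0 sym_w').
  have [eq_x eq_kf eq_pt] := sym_lift_uniq sym_kf sym_kf' pos_pt pos_pt' eq_lift.
  case: w w' {lift_sym eq_w eq_lift sym_kf sym_kf' pos_pt pos_pt' sym_w sym_w'}
    wit_x sym_f pos_p wit_x' sym_f' pos_p' eq_x eq_kf eq_pt
    => [[x f] p] [[x' f'] p'] /= wit_x sym_f pos_p _ sym_f' pos_p' <- eq_kf eq_pt.
  (* Once the two witnesses agree, both triples use the same [k x] and [t x], which cancel. *)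
  have [sym_k pos_t] := (k_sym _ wit_x.1, t_pos _ wit_x).
  rewrite -(sym_compK sym_f sym_k) eq_kf (sym_compK sym_f' sym_k).
  by rewrite -(sym_compKr pos_t pos_p) eq_pt (sym_compKr pos_t pos_p').
- move=> th sym_th; have conf_xhat : configuration xhat.
    by have [Ff <- _] := k_sym _ X_xhat; apply: conf_gdom Ff.
  have [x [f [p [sym_f pos_p eq_th]]]] :=
    sym_lift conf_xhat (sym_from_to_comp sym_t0 sym_th).
  have wit_x : wit x.
    by split; [apply: symmetry_class_closed X_class X_xhat _; exists f|exists p].
  have [sym_k pos_t] := (k_sym _ wit_x.1, t_pos _ wit_x).
  (* Stripping the reference symmetries from the two factors turns them into symmetries of [xhat]
     and of [c]. *)
  exists (x, gcomp (ginv (k x)) f, gcomp p (ginv (t x))).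
    split; first split=> //=; first exact: sym_from_to_comp (sym_from_to_inv sym_k).
    exact: sym_from_to_comp (sym_from_to_inv pos_t) pos_p.
  rewrite /lift /= (sym_compVK sym_f sym_k) (sym_compVKr pos_t pos_p) -eq_th.
  exact: sym_compKr sym_t0 sym_th.
Qed.

Theorem theoremC4 (A : game) (sigma : strategy A)
    (XA : set {fset A}) (XA_complete : complete_class (@payoff A) XA)
    (X : set {fset sigma}) (X_class : symmetry_class (strat_sym sigma) X)
    (X_covered : forall x, X x -> pos_covered x)
    (X_display : forall x, X x -> XA (@display A sigma @` x)%fset)
    (xhat : {fset sigma}) (xhat_in : X xhat)
    (xhat_pos : symmetric_confs (tcg_pos A)
                  (@display A sigma @` xhat)%fset (chosen XA)) :
  let wit := wit_pos XA X in
  let negA : set {fset A * A} :=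
    sym_from_to (tcg_neg A) (chosen XA) (chosen XA) in
  let symX : set {fset sigma * sigma} :=
    sym_from_to (strat_sym sigma) xhat xhat in
  [/\ finite_set wit, finite_set negA, finite_set symX &
      ((#|` fset_set wit|)%:R =
       (#|` fset_set negA|)%:R / (#|` fset_set symX|)%:R :> rat)%R].
Proof.
move=> wit negA symX.
pose c := chosen XA.
pose posA := sym_from_to (tcg_pos A) c c.
have fin_neg : finite_set negA by apply: finite_sym_from_to.
have fin_pos : finite_set posA by apply: finite_sym_from_to.
have fin_symX : finite_set symX by apply: finite_sym_from_to.
have fin_symA := finite_sym_from_to (tcg_sym A) c c.
have [h h_bij] := wit_lift_bij X_class xhat_in xhat_pos.
have [fin_prod card_prod] := card_fset_set_bij h_bij fin_symA.
have [_ card_fact] :=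
  card_fset_set_bij (canonical_factor_bij (chosen_canonical XA_complete)) fin_symA.
have pos_id : posA (gid c).
  apply: sym_from_to_id; case: xhat_pos => p [pos_p _ cod_p].
  by rewrite /c -cod_p; apply: conf_gcod pos_p.
have symX_id : symX (gid xhat).
  apply: sym_from_to_id.
  case: (symmetry_class_symmetric X_class xhat_in xhat_in) => f [Ff <- _].
  exact: conf_gdom Ff.
(* Each witness is the first component of a triple in the finite product, completed by two
   identities. *)
have fin_wit : finite_set wit.
  apply: sub_finite_set (finite_image (fun w => w.1.1) fin_prod) => x wit_x.
  by exists (x, gid xhat, gid c).
split=> //.
(* Identities make both groups nonempty: the factor for [posA] can be cancelled, and division by
   that for [symX] is meaningful. *)
have card_pos_gt0 : 0 < #|` fset_set posA|.
  by rewrite cardfs_gt0; apply/fset0Pn; exists (gid c); rewrite in_fset_set // inE.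
have card_symX_gt0 : 0 < #|` fset_set symX|.
  by rewrite cardfs_gt0; apply/fset0Pn; exists (gid xhat); rewrite in_fset_set // inE.
have fin_witX : finite_set (wit `*` symX)%classic by apply: finite_setX.
(* Equating the two counts, [mulnC] brings the factor for [posA] to the front on the left, where it
   already stands on the right. *)
move: card_prod; rewrite -card_fact !fset_setX // !cardfsM mulnC => /eqP.
rewrite eqn_pmul2l // => /eqP card_eq.
apply: (GRing.mulIf (x := #|` fset_set symX|%:R%R)).
  by rewrite Num.Theory.pnatr_eq0 -lt0n.
by rewrite GRing.mulfVK ?Num.Theory.pnatr_eq0 -?lt0n // -GRing.natrM card_eq.
Qed.
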